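(* Let $\{x_1,\dots,x_n\}$ be a linearly independent system of vectors in $H$, let $M:=\operatorname{span}\{x_1,\dots,x_n\}$, and let $x\in H$ with $x\notin M^{\perp}$. Then $$d^2(x,M)\le\frac{\|x\|^2\left(\sum_{i,j=1}^n|\langle x_i,x_j\rangle|^2\right)^{1/2}-\sum_{i=1}^n|\langle x,x_i\rangle|^2}{\left(\sum_{i,j=1}^n|\langle x_i,x_j\rangle|^2\right)^{1/2}},$$ or, equivalently, $$\Gamma(x_1,\dots,x_n,x)\le\frac{\|x\|^2\left(\sum_{i,j=1}^n|\langle x_i,x_j\rangle|^2\right)^{1/2}-\sum_{i=1}^n|\langle x,x_i\rangle|^2}{\left(\sum_{i,j=1}^n|\langle x_i,x_j\rangle|^2\right)^{1/2}}\cdot\Gamma(x_1,\dots,x_n).$$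
   Context: $(H;\langle\cdot,\cdot\rangle)$ is an inner product space over the real or complex number field $\mathbb{K}$, with norm $\|x\|=\langle x,x\rangle^{1/2}$. $M^{\perp}$ is the orthogonal complement of $M$ in $H$, and $d(x,M)=\inf_{y\in M}\|x-y\|$ is the distance from $x$ to $M$. For vectors $y_1,\dots,y_m\in H$, $\Gamma(y_1,\dots,y_m)$ denotes the Gram determinant, i.e. the determinant of the $m\times m$ matrix whose $(i,j)$-entry is $\langle y_i,y_j\rangle$. *)

(* Defs.v *)
From HB Require Import structures.
From mathcomp Require Export all_boot all_order all_algebra.
From mathcomp Require Export sesquilinear complex boolp classical_sets reals.

Set Implicit Arguments.
Unset Strict Implicit.
Unset Printing Implicit Defensive.

Import Order.TTheory GRing.Theory Num.Theory.
Local Open Scope classical_set_scope.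
Local Open Scope ring_scope.

Variant scalar_kind := RealScalars | ComplexScalars.

(* The field over which H is an inner product space: R or R[i]. On R[i] the
   order is x <= y iff y - x is a nonnegative real, and `|z| is the modulus
   seen as an element of R[i]. *)
Definition scalar (R : realType) (k : scalar_kind) : numFieldType :=
  match k with RealScalars => R | ComplexScalars => R[i] end.

Definition scalar_conj (R : realType) (k : scalar_kind) :
    scalar R k -> scalar R k :=
  match k return scalar R k -> scalar R k with
  | RealScalars => idfun
  | ComplexScalars => @Num.conj R[i]
  end.

Definition scalar_re (R : realType) (k : scalar_kind) : scalar R k -> R :=
  match k return scalar R k -> R with
  | RealScalars => idfun
  | ComplexScalars => @complex.Re R
  end.

Definition real_scalar (R : realType) (k : scalar_kind) : R -> scalar R k :=
  match k return R -> scalar R k with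
  | RealScalars => idfun
  | ComplexScalars => real_complex R
  end.

Definition scalar_abs (R : realType) (k : scalar_kind) (z : scalar R k) : R :=
  scalar_re `|z|.

Section LinearAlgebra.
Variables (K : nzRingType) (H : lmodType K).

(* The library's free and span require a finite-dimensional vectType. *)
Definition lin_indep (n : nat) (xs : n.-tuple H) : Prop :=
  forall a : 'I_n -> K,
    \sum_(i < n) a i *: tnth xs i = 0 -> forall i, a i = 0.

Definition lin_span (n : nat) (xs : n.-tuple H) : set H :=
  [set y | exists a : 'I_n -> K, y = \sum_(i < n) a i *: tnth xs i].

End LinearAlgebra.

Section InnerProductSpace.
Variables (R : realType) (k : scalar_kind) (H : lmodType (scalar R k)).
(* A positive definite Hermitian form, linear in its first argument. *)
Variable ip : {dot H for @scalar_conj R k}.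

Definition ip_norm (x : H) : R := Num.sqrt (scalar_re (ip x x)).

Definition ortho_compl (M : set H) : set H :=
  [set z | forall y, M y -> ip z y = 0].

Definition ip_dist (x : H) (M : set H) : R :=
  inf [set ip_norm (x - y) | y in M].

Definition gram (m : nat) (ys : m.-tuple H) : scalar R k :=
  \det (\matrix_(i < m, j < m) ip (tnth ys i) (tnth ys j)).

End InnerProductSpace.

(* Main.v *)
(** Subtracting from [x] the vector [S^-1 *: \sum_i <x, x_i> x_i] of [M] and
    bounding [|\sum_i <x, x_i> x_i|^2] by [S * \sum_i |<x, x_i>|^2]
    (Cauchy-Schwarz over pairs of indices) gives a point of [M] at squared
    distance at most [B] from [x], whence the bound on [d(x, M)].  For the Gram
    determinants, [Gamma(x_1, ..., x_n, x) = Gamma(x_1, ..., x_n) |x - p|^2]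
    where [p] is the orthogonal projection of [x] on [M], and [x - p] is at most
    as long as the previous difference. *)
From HB Require Import structures.
From mathcomp Require Import ring.
Require Import Defs.

Set Implicit Arguments.
Unset Strict Implicit.
Unset Printing Implicit Defensive.

Import Order.TTheory GRing.Theory Num.Theory.
Local Open Scope classical_set_scope.
Local Open Scope ring_scope.

(** * Conjugation, real embedding and modulus, uniformly over the two scalar fields *)

Lemma scalar_conj_is_zmod_morphism (R : realType) (k : scalar_kind) :
  zmod_morphism (@scalar_conj R k).
Proof. by case: k => // x y; apply: rmorphB. Qed.

Lemma scalar_conj_is_monoid_morphism (R : realType) (k : scalar_kind) :
  monoid_morphism (@scalar_conj R k).
Proof. by case: k => //; split; [apply: rmorph1 | apply: rmorphM]. Qed.

HB.instance Definition _ (R : realType) (k : scalar_kind) :=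
  GRing.isZmodMorphism.Build _ _ (@scalar_conj R k)
    (@scalar_conj_is_zmod_morphism R k).
HB.instance Definition _ (R : realType) (k : scalar_kind) :=
  GRing.isMonoidMorphism.Build _ _ (@scalar_conj R k)
    (@scalar_conj_is_monoid_morphism R k).

Lemma real_scalar_is_zmod_morphism (R : realType) (k : scalar_kind) :
  zmod_morphism (@real_scalar R k).
Proof. by case: k => // x y; apply: (rmorphB (real_complex R)). Qed.

Lemma real_scalar_is_monoid_morphism (R : realType) (k : scalar_kind) :
  monoid_morphism (@real_scalar R k).
Proof.
by case: k => //; split; [| apply: (rmorphM (real_complex R))].
Qed.

HB.instance Definition _ (R : realType) (k : scalar_kind) :=
  GRing.isZmodMorphism.Build _ _ (@real_scalar R k)
    (@real_scalar_is_zmod_morphism R k).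
HB.instance Definition _ (R : realType) (k : scalar_kind) :=
  GRing.isMonoidMorphism.Build _ _ (@real_scalar R k)
    (@real_scalar_is_monoid_morphism R k).

Section Scalars.
Variables (R : realType) (k : scalar_kind).
Implicit Types (r s : R) (z : scalar R k).

Lemma mul_scalar_conj z : z * scalar_conj z = `|z| ^+ 2.
Proof.
case: k z => [z | z] /=; first by rewrite real_normK ?num_real.
by rewrite normCK.
Qed.

Lemma scalar_conj_ge0 z : 0 <= z -> scalar_conj z = z.
Proof. by case: k z => [z | z] //= /geC0_conj. Qed.

Lemma scalar_reK z : 0 <= z -> real_scalar k (scalar_re z) = z.
Proof. by case: k z => [z | z] //= /ger0_real/RRe_real. Qed.

Lemma ler_real_scalar r s : (real_scalar k r <= real_scalar k s) = (r <= s).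
Proof. by case: k => //=; apply: lecR. Qed.

Lemma scalar_absK z : real_scalar k (scalar_abs z) = `|z|.
Proof. exact/scalar_reK/normr_ge0. Qed.

Lemma scalar_abs_eq0 z : (scalar_abs z == 0) = (z == 0).
Proof.
by rewrite -(fmorph_eq0 (@real_scalar R k)) /= scalar_absK normr_eq0.
Qed.

End Scalars.

(** Cauchy-Schwarz by a weighted arithmetic-geometric inequality on each term. The weights [B / A]
    and [A / B] make each of the two sums of squares contribute exactly [A * B / 2]. *)
Lemma sum_mul_le_sqrt (R : realFieldType) (I : finType) (a b : I -> R) (A B : R) :
  0 < A -> 0 < B -> \sum_i a i ^+ 2 = A ^+ 2 -> \sum_i b i ^+ 2 = B ^+ 2 ->
  \sum_i a i * b i <= A * B.
Proof.
move=> A0 B0 sa sb.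
have amgm i : a i * b i <= (B / A / 2) * a i ^+ 2 + (A / B / 2) * b i ^+ 2.
  rewrite -subr_ge0.
  have -> : (B / A / 2) * a i ^+ 2 + (A / B / 2) * b i ^+ 2 - a i * b i
     = (a i * B - A * b i) ^+ 2 / (2 * A * B).
    by field; rewrite !gt_eqF.
  by rewrite divr_ge0 ?sqr_ge0 ?mulr_ge0 // ltW.
apply: le_trans (ler_sum _ (fun i _ => amgm i)) _.
rewrite big_split /= -!mulr_sumr sa sb le_eqVlt; apply/orP; left; apply/eqP.
by field; rewrite !gt_eqF.
Qed.

(* Stated over an abstract field because [field] does not terminate on the
   concrete structure [scalar R k]. *)
Lemma bound_sub_sqnorm (F : fieldType) (a c t w : F) : t != 0 ->
  (a * t - c) / t - (a - t^-1 * c - (t^-1 * c - t^-1 * (t^-1 * w)))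
    = t^-1 ^+ 2 * (c * t - w).
Proof. by move=> t0; field. Qed.

(** * Families extended by a last vector *)

Lemma tnth_rcons_lift (T : Type) (n : nat) (s : n.-tuple T) (y : T) (i : 'I_n) :
  tnth [tuple of rcons s y] (lift ord_max i) = tnth s i.
Proof.
by rewrite !(tnth_nth y) /= /bump leqNgt ltn_ord nth_rcons size_tuple ltn_ord.
Qed.

Lemma tnth_rcons_max (T : Type) (n : nat) (s : n.-tuple T) (y : T) :
  tnth [tuple of rcons s y] ord_max = y.
Proof. by rewrite (tnth_nth y) nth_rcons size_tuple ltnn eqxx. Qed.

Lemma tuple_rconsP (T : Type) (n : nat) (t : n.+1.-tuple T) :
  exists (s : n.-tuple T) (y : T), t = [tuple of rcons s y].
Proof.
case: t => t; case/lastP: t => [|s y] // st.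
have ss : size s == n by move: st; rewrite size_rcons eqSS.
by exists (Tuple ss), y; apply: val_inj.
Qed.

Lemma big_ord_lift_max (V : zmodType) (n : nat) (F : 'I_n.+1 -> V) :
  \sum_i F i = \sum_(i < n) F (lift ord_max i) + F ord_max.
Proof.
rewrite big_ord_recr; congr (_ + _); apply: eq_bigr => i _; congr F.
by apply: val_inj; rewrite /= /bump leqNgt ltn_ord.
Qed.

Lemma lin_indep_rcons (K : nzRingType) (H : lmodType K) (n : nat)
    (ys : n.-tuple H) (y : H) :
  lin_indep [tuple of rcons ys y] -> lin_indep ys.
Proof.
move=> li a sa0 i.
(* A relation among [ys] becomes one among the longer family with coefficient 0 on [y]. *)
pose b (j : 'I_n.+1) := if unlift ord_max j is Some j' then a j' else 0.
have := li b; rewrite big_ord_lift_max /b unlift_none scale0r addr0.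
under eq_bigr do rewrite liftK tnth_rcons_lift.
by move=> /(_ sa0) /(_ (lift ord_max i)); rewrite liftK.
Qed.

(** * Gram determinants, orthogonal projection and distance to a span *)

Section Gram.
Variables (R : realType) (k : scalar_kind) (H : lmodType (scalar R k)).
Variable ip : {dot H for @scalar_conj R k}.
Local Notation K := (scalar R k).

Lemma ip_gt0 (u : H) : u != 0 -> 0 < ip u u.
Proof. exact: neq0_dnorm_gt0. Qed.

Lemma ip_ge0 (u : H) : 0 <= ip u u.
Proof.
by have [->|/ip_gt0/ltW//] := eqVneq u 0; rewrite linear0l.
Qed.

Lemma ip_eq0 (u : H) : ip u u = 0 -> u = 0.
Proof.
by move=> u0; apply/eqP; apply: contraT => /ip_gt0; rewrite u0 ltxx.
Qed.

Lemma ipC (u v : H) : ip u v = scalar_conj (ip v u).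
Proof. by rewrite hermC expr0 mul1r. Qed.

Lemma ip_suml (n : nat) (a : 'I_n -> K) (ys : n.-tuple H) (v : H) :
  ip (\sum_i a i *: tnth ys i) v = \sum_i a i * ip (tnth ys i) v.
Proof.
by rewrite linear_sumlz; apply: eq_bigr => i _; rewrite linearZl_LR.
Qed.

Lemma ip_sumr (n : nat) (a : 'I_n -> K) (ys : n.-tuple H) (v : H) :
  ip v (\sum_i a i *: tnth ys i) = \sum_i scalar_conj (a i) * ip v (tnth ys i).
Proof.
by rewrite linear_sumr; apply: eq_bigr => i _; rewrite linearZr_LR.
Qed.

Lemma ortho_complP (n : nat) (ys : n.-tuple H) (x : H) :
  (forall i, ip x (tnth ys i) = 0) -> ortho_compl ip (lin_span ys) x.
Proof.
by move=> x0 _ [a ->]; rewrite ip_sumr big1 // => i _; rewrite x0 mulr0.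
Qed.

Lemma ip_norm_sqr (u : H) : ip_norm ip u ^+ 2 = scalar_re (ip u u).
Proof.
rewrite sqr_sqrtr // -(ler_real_scalar k) rmorph0 scalar_reK; exact: ip_ge0.
Qed.

Lemma real_scalar_ip_norm (u : H) : real_scalar k (ip_norm ip u ^+ 2) = ip u u.
Proof. by rewrite ip_norm_sqr scalar_reK ?ip_ge0. Qed.

(** A row vector killed by the Gram matrix is the coefficient vector of a combination [w] orthogonal
    to every [ys] entry, hence to itself; so [w] is 0 and independence kills the coefficients. *)
Lemma gram_neq0 (n : nat) (ys : n.-tuple H) : lin_indep ys -> gram ip ys != 0.
Proof.
move=> li; apply/det0P => -[v v0 vG0].
case/eqP: v0; apply/rowP => i; rewrite mxE; apply: (li (v 0)).
set w := \sum_i _.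
have wy j : ip w (tnth ys j) = 0.
  have /rowP/(_ j) := vG0; rewrite !mxE /w ip_suml => vG0j; rewrite -[RHS]vG0j.
  by apply: eq_bigr => l _; rewrite mxE.
by apply: ip_eq0; apply: (ortho_complP wy); exists (v 0).
Qed.

Lemma orthogonal_projection (n : nat) (ys : n.-tuple H) (x : H) :
  lin_indep ys ->
  exists2 p, lin_span ys p & forall j, ip (x - p) (tnth ys j) = 0.
Proof.
move=> /gram_neq0; set G : 'M[K]_n := \matrix_(i, j) ip (tnth ys i) (tnth ys j).
rewrite -[gram _ _]/(\det G) => G0.
have Gu : G \in unitmx by rewrite unitmxE unitfE.
(* Orthogonality of [x - p] to each entry of [ys] is the linear system
   [a *m G = \row_j ip x (tnth ys j)], solvable since [G] is invertible. *)
pose a := (\row_j ip x (tnth ys j)) *m invmx G.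
exists (\sum_i a 0 i *: tnth ys i) => [|j]; first by exists (a 0).
rewrite linearBl /= ip_suml; apply/eqP; rewrite subr_eq0; apply/eqP.
have /rowP/(_ j) : a *m G = \row_j ip x (tnth ys j) by rewrite mulmxKV.
rewrite !mxE => <-; apply: eq_bigr => i _.
by rewrite [G i j]mxE.
Qed.

(** The determinant is additive in its last row, so [x] there splits as [(x - p) + p]. The [p] part
    vanishes because its row depends on the others; the [x - p] part has a single possibly nonzero
    entry in that row. *)
Lemma gram_rcons (n : nat) (ys : n.-tuple H) (x p : H) :
    lin_span ys p -> (forall j, ip (x - p) (tnth ys j) = 0) ->
  gram ip [tuple of rcons ys x] = ip (x - p) (x - p) * gram ip ys.
Proof.
move=> Mp xp0; have [a pE] := Mp; set t := [tuple of rcons ys x].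
(* Only the left argument of the last row varies with [f]; the columns keep pairing with [x]
   last. *)
pose rowmod (f : H) : 'M[K]_n.+1 := \matrix_(i, j)
  ip (if unlift ord_max i is Some i' then tnth ys i' else f) (tnth t j).
have tE i : tnth t i = if unlift ord_max i is Some i' then tnth ys i' else x.
  by case: unliftP => [j|] ->; rewrite ?tnth_rcons_lift ?tnth_rcons_max.
have -> : gram ip t = \det (rowmod x).
  by congr (\det _); apply/matrixP => i j; rewrite !mxE [in tnth t i]tE.
have row'E f g : row' ord_max (rowmod f) = row' ord_max (rowmod g).
  by apply/matrixP => i j; rewrite !mxE liftK.
rewrite (@determinant_multilinear _ _ _ (rowmod (x - p)) (rowmod p) ord_max 1 1) //;
  last first.
  apply/rowP => j; rewrite !mxE unlift_none !mul1r -linearDl.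
  by rewrite subrK.
have -> : \det (rowmod p) = 0.
  apply/eqP/det0P.
  (* The relation expressing [p] through [ys]: its coefficients, then -1 on [p] itself. *)
  exists (\row_i if unlift ord_max i is Some i' then a i' else -1).
    apply/eqP => /rowP/(_ ord_max); rewrite !mxE unlift_none => /eqP.
    by rewrite oppr_eq0 oner_eq0.
  apply/rowP => j; rewrite !mxE big_ord_lift_max !mxE !unlift_none mulN1r.
  apply/eqP; rewrite subr_eq0 pE ip_suml; apply/eqP.
  by apply: eq_bigr => i _; rewrite !mxE !liftK.
rewrite mul1r mulr0 addr0 (expand_det_row _ ord_max) big_ord_lift_max big1.
  rewrite add0r mxE unlift_none tnth_rcons_max.
  have -> : ip (x - p) x = ip (x - p) (x - p).
    by rewrite [in RHS]linearBr /= (ortho_complP xp0 Mp) subr0.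
  congr (_ * _); rewrite /cofactor -signr_odd oddD addbb expr0 mul1r.
  congr (\det _); apply/matrixP => i j.
  by rewrite !mxE liftK tnth_rcons_lift.
by move=> j _; rewrite mxE unlift_none tnth_rcons_lift xp0 mul0r.
Qed.

(** Each added vector multiplies the determinant by a squared distance, starting from the empty
    determinant 1. *)
Lemma gram_ge0 (n : nat) (ys : n.-tuple H) : lin_indep ys -> 0 <= gram ip ys.
Proof.
elim: n ys => [|n IHn] ys li; first by rewrite /gram det_mx00.
have [s [y ysE]] := tuple_rconsP ys; subst ys.
have lis := lin_indep_rcons li.
have [p Mp /(gram_rcons Mp) ->] := orthogonal_projection y lis.
by rewrite mulr_ge0 ?ip_ge0 ?IHn.
Qed.

Lemma lin_spanB (n : nat) (ys : n.-tuple H) (u v : H) :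
  lin_span ys u -> lin_span ys v -> lin_span ys (u - v).
Proof.
move=> [a ->] [b ->]; exists (fun i => a i - b i).
by rewrite -sumrB; apply: eq_bigr => i _; rewrite scalerBl.
Qed.

(** Pythagoras: [x - y] is the sum of the orthogonal vectors [x - p] and [p - y]. *)
Lemma projection_closest (n : nat) (ys : n.-tuple H) (x p y : H) :
    lin_span ys p -> (forall j, ip (x - p) (tnth ys j) = 0) ->
    lin_span ys y ->
  ip (x - p) (x - p) <= ip (x - y) (x - y).
Proof.
move=> Mp xp0 My.
have opy : ip (x - p) (p - y) = 0.
  exact: (ortho_complP xp0 (lin_spanB Mp My)).
rewrite -[x - y](subrKA p) (hnormDd opy) lerDl.
exact: ip_ge0.
Qed.

Lemma gram_rcons_le (n : nat) (ys : n.-tuple H) (x y : H) :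
    lin_indep ys -> lin_span ys y ->
  gram ip [tuple of rcons ys x] <= ip (x - y) (x - y) * gram ip ys.
Proof.
move=> li My; have [p Mp xp0] := orthogonal_projection x li.
rewrite (gram_rcons Mp xp0) ler_wpM2r ?gram_ge0 //.
exact: projection_closest Mp xp0 My.
Qed.

Lemma ip_dist_sqr_le (n : nat) (ys : n.-tuple H) (x y : H) :
  lin_span ys y -> ip_dist ip x (lin_span ys) ^+ 2 <= ip_norm ip (x - y) ^+ 2.
Proof.
move=> My; set M := lin_span ys.
have lb0 : lbound [set ip_norm ip (x - u) | u in M] 0.
  by move=> _ [u _ <-]; apply: sqrtr_ge0.
have neM : [set ip_norm ip (x - u) | u in M] !=set0.
  by exists (ip_norm ip (x - y)), y.
rewrite ler_pXn2r ?nnegrE ?sqrtr_ge0 //; last exact: lb_le_inf.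
by apply: ge_inf; [exists 0 | exists y].
Qed.

Lemma ip_sum_le (n : nat) (c : 'I_n -> K) (ys : n.-tuple H) (C S : R) :
    0 < C -> 0 < S -> \sum_i scalar_abs (c i) ^+ 2 = C ->
    \sum_i \sum_j scalar_abs (ip (tnth ys i) (tnth ys j)) ^+ 2 = S ^+ 2 ->
  ip (\sum_i c i *: tnth ys i) (\sum_i c i *: tnth ys i)
    <= real_scalar k (C * S).
Proof.
move=> C0 S0 cC gS; set w := \sum_i _.
pose a (q : 'I_n * 'I_n) := scalar_abs (c q.1) * scalar_abs (c q.2).
pose b (q : 'I_n * 'I_n) := scalar_abs (ip (tnth ys q.1) (tnth ys q.2)).
have sa : \sum_q a q ^+ 2 = C ^+ 2.
  rewrite -(pair_bigA _ (fun i j => a (i, j) ^+ 2)) /= expr2 -{1}cC mulr_suml.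
  apply: eq_bigr => i _; rewrite -cC mulr_sumr; apply: eq_bigr => j _.
  by rewrite exprMn.
have sb : \sum_q b q ^+ 2 = S ^+ 2.
  by rewrite -(pair_bigA _ (fun i j => b (i, j) ^+ 2)).
apply: (@le_trans _ _ (real_scalar k (\sum_q a q * b q))); last first.
  by rewrite ler_real_scalar; apply: sum_mul_le_sqrt.
(* Being nonnegative, [ip w w] equals its modulus, so the triangle inequality applies to its
   expansion over pairs of indices. *)
rewrite -[ip w w]ger0_norm ?ip_ge0 //.
have -> : ip w w = \sum_q c q.1 * (scalar_conj (c q.2) * ip (tnth ys q.1) (tnth ys q.2)).
  rewrite -(pair_bigA _ (fun i j =>
    c i * (scalar_conj (c j) * ip (tnth ys i) (tnth ys j)))) /= {1}/w ip_suml.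
  by apply: eq_bigr => i _; rewrite ip_sumr mulr_sumr.
apply: le_trans (ler_norm_sum _ _ _) _.
rewrite rmorph_sum; apply: ler_sum => q _.
have normJ (z : K) : `|scalar_conj z| = `|z|.
  by case: (k) z => //= z; rewrite norm_conjC.
by rewrite !normrM normJ !rmorphM /= !scalar_absK mulrA.
Qed.

End Gram.

Theorem theorem5 (R : realType) (k : scalar_kind) (H : lmodType (scalar R k))
    (ip : {dot H for @scalar_conj R k})
    (n : nat) (xs : n.-tuple H) (x : H)
    (hxs : lin_indep xs) (hx : ~ ortho_compl ip (lin_span xs) x) :
  let S : R := Num.sqrt (\sum_(i < n) \sum_(j < n)
                 scalar_abs (ip (tnth xs i) (tnth xs j)) ^+ 2) in
  let B : R := (ip_norm ip x ^+ 2 * S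
                 - \sum_(i < n) scalar_abs (ip x (tnth xs i)) ^+ 2) / S in
  ip_dist ip x (lin_span xs) ^+ 2 <= B
  /\ gram ip [tuple of rcons xs x] <= real_scalar k B * gram ip xs.
Proof.
move=> S B; pose c i := ip x (tnth xs i).
pose C := \sum_i scalar_abs (c i) ^+ 2.
(* Otherwise [x] would be orthogonal to all of the span, against [hx]. This index makes [C]
   positive, and also [S], since [tnth xs i0] cannot be 0. *)
have [i0 ci0] : exists i, c i != 0.
  apply/existsP; apply: contra_notT hx; rewrite negb_exists => /forallP c0.
  by apply: ortho_complP => i; apply/eqP; move: (c0 i); rewrite negbK.
have C0 : 0 < C.
  rewrite /C (bigD1 i0) //= ltr_pwDl ?sumr_ge0 // => [|i _]; last exact: sqr_ge0.
  by rewrite exprn_even_gt0 //= scalar_abs_eq0.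
have S0 : 0 < S.
  rewrite sqrtr_gt0 (bigD1 i0) //= (bigD1 i0) //= -addrA ltr_pwDl //.
    rewrite exprn_even_gt0 //= scalar_abs_eq0; apply: contra_neq ci0 => /ip_eq0.
    by rewrite /c => ->; rewrite linear0r.
  rewrite addr_ge0 // !sumr_ge0 // => i _; rewrite ?sumr_ge0 ?sqr_ge0 // => j _.
  exact: sqr_ge0.
pose w := \sum_i c i *: tnth xs i.
pose T := real_scalar k S.
have T0 : 0 < T.
  by rewrite lt_neqAle -(rmorph0 (@real_scalar R k)) ler_real_scalar ltW //
     (inj_eq (fmorph_inj _)) lt_eqF.
have Tn0 : T != 0 by rewrite gt_eqF.
have My : lin_span xs (T^-1 *: w).
  exists (fun i => T^-1 * c i); rewrite scaler_sumr.
  by apply: eq_bigr => i _; rewrite scalerA.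
have wle : ip w w <= real_scalar k (C * S).
  apply: ip_sum_le => //.
  by rewrite sqr_sqrtr // sumr_ge0 // => i _; rewrite sumr_ge0 // => j _; rewrite sqr_ge0.
have xw : ip x w = real_scalar k C.
  rewrite ip_sumr rmorph_sum; apply: eq_bigr => i _.
  by rewrite mulrC mul_scalar_conj rmorphXn /= scalar_absK.
have wx : ip w x = real_scalar k C.
  by rewrite ipC xw scalar_conj_ge0 // -(rmorph0 (@real_scalar R k)) ler_real_scalar ltW.
have zle : ip (x - T^-1 *: w) (x - T^-1 *: w) <= real_scalar k B.
  have TJ : scalar_conj T^-1 = T^-1 by rewrite scalar_conj_ge0 // invr_ge0 ltW.
  (* Both cross terms equal [T^-1] times [C], because [T] is a positive real and [ip x w], [ip w x]
     are both the real number [C]. *)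
  rewrite linearBl !linearBr !linearZl_LR !linearZr_LR /= TJ xw wx.
  rewrite /B fmorph_div rmorphB rmorphM /= real_scalar_ip_norm -/T.
  rewrite -/c -/C -subr_ge0.
  (* The gap between [B] and the squared length is [T^-1 ^+ 2] times [C * S - ip w w], nonnegative
     by [wle]. *)
  rewrite bound_sub_sqnorm //.
  by rewrite mulr_ge0 ?exprn_ge0 ?invr_ge0 ?(ltW T0) // subr_ge0 /T -rmorphM.
split.
  apply: le_trans (ip_dist_sqr_le ip x My) _.
  by rewrite -(ler_real_scalar k) real_scalar_ip_norm.
apply: le_trans (gram_rcons_le ip x hxs My) _.
by rewrite ler_wpM2r ?gram_ge0.
Qed.
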